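(* For every positive integer $n$, there exists an edge coloring of the complete graph $K_n$ with $2^{6\sqrt{\log n}}$ colors such that for every set $X$ of colors with $|X|\ge 2$, the subgraph of $K_n$ formed by the edges whose color lies in $X$ has chromatic number at most $2^{3\sqrt{|X|\log|X|}}$.
   Context: Logarithms are base 2; the number of colors $2^{6\sqrt{\log n}}$ is understood up to rounding (the paper omits floor and ceiling signs). *)

(* Defs.v *)
From mathcomp Require Import all_boot.
From Stdlib Require Import Reals.
Set Implicit Arguments. Unset Strict Implicit. Unset Printing Implicit Defensive.

Definition log2 (x : R) : R := (ln x / ln 2)%R.

Definition nfloor (x : R) : nat := Z.to_nat (Int_part x).

Definition colorableb (n : nat) (E : rel 'I_n) (k : nat) : bool :=
  [exists f : {ffun 'I_n -> 'I_k}, [forall u, forall v, E u v ==> (f u != f v)]].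

Lemma colorable_n (n : nat) (E : rel 'I_n) (Eirr : irreflexive E) :
  exists k, colorableb E k.
Proof.
exists n; apply/existsP; exists [ffun u => u]; apply/forallP => u; apply/forallP => v.
apply/implyP => Euv; rewrite !ffunE; apply/negP => /eqP euv.
by rewrite euv Eirr in Euv.
Qed.

Definition color_subgraph (n m : nat) (c : 'I_n -> 'I_n -> 'I_m) (X : {set 'I_m})
  : rel 'I_n := fun u v => (u != v) && (c u v \in X).

Lemma color_subgraph_irr n m (c : 'I_n -> 'I_n -> 'I_m) X :
  irreflexive (color_subgraph c X).
Proof. by move=> u; rewrite /color_subgraph eqxx. Qed.

Definition chromatic_number n (E : rel 'I_n) (Eirr : irreflexive E) : nat :=
  ex_minn (colorable_n Eirr).

(* Main.v *)
(* Identify the vertices with words of length t over 2^t letters, t minimal with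
   n <= 2^(t^2), and colour uv by its difference pattern together with the smaller
   of the two letters at the first differing index, a variant of Mubayi's colouring
   with 2^(2t) colours.

   Let Y be a set of colours. Asking whether the letter of u at the first index j of
   a colour c of Y is the letter recorded in c splits the vertices in two: on the
   "no" side c does not occur, and on the "yes" side no colour whose pattern contains
   j occurs. Branching while some such j lies in more than e patterns gives
   L(s) <= L(s - 1) + L(s - e - 1) for the number of parts. In the end every
   first index lies in at most e patterns, so Y splits greedily into e groups in
   which no pattern contains the first index of another colour of the group; the
   parity of the number of colours in a group whose recorded letter is attained
   then properly 2-colours the group, and 2^e classes suffice. With
   q = sqrt (s log s), e = floor (2q) and L(s) <= 2^(q) the product is at most 2^(3q). *)
Require Import Defs.
From mathcomp Require Import all_boot.
From Stdlib Require Import ZArith Reals Lra Lia.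
From mathcomp Require Import ssrnat.
Set Implicit Arguments. Unset Strict Implicit. Unset Printing Implicit Defensive.

(** * Words, difference patterns and colours *)

Definition word t p := t.-tuple 'I_p.+1.
Definition color t p : finType := ('I_p.+1 * t.-tuple bool)%type.

Definition letter t p (u : word t p) (j : nat) : 'I_p.+1 := nth ord0 u j.

Definition diff t p (u v : word t p) : t.-tuple bool :=
  [tuple tnth u j != tnth v j | j < t].

Definition active t p (c : color t p) (j : nat) : bool := nth false c.2 j.

Definition first t p (c : color t p) : nat := index true c.2.

(* Junk on the diagonal: an all-[false] pattern, which [true \in c.2] excludes below. *)
Definition word_color t p (u v : word t p) : color t p :=
  let i := index true (diff u v) in
  (if letter u i <= letter v i then letter u i else letter v i,
   diff u v).

Lemma active_color t p (u v : word t p) j :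
  active (word_color u v) j = (letter u j != letter v j).
Proof.
rewrite /active /letter /=; case: (ltnP j t) => [ltjt | letj].
  rewrite -[j]/(val (Ordinal ltjt)) -(tnth_nth false (diff u v)).
  by rewrite -(tnth_nth ord0 u) -(tnth_nth ord0 v) tnth_mktuple.
(* Past the end, both letters are the default [ord0] and the pattern defaults to [false]. *)
by rewrite !nth_default ?size_tuple ?card_ord ?eqxx.
Qed.

Lemma active_first t p (c : color t p) : true \in c.2 -> active c (first c).
Proof. exact: nth_index. Qed.

Lemma first_le t p (c : color t p) j : active c j -> first c <= j.
Proof. by rewrite leqNgt => cj; apply/negP => /(before_find false); rewrite -/(active c j) cj. Qed.

Lemma has_color t p (u v : word t p) : u != v -> true \in (word_color u v).2.
Proof.
apply: contraR => nouv; apply/eqP/eq_from_tnth => j; apply/eqP.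
have := mem_tnth j (diff u v); rewrite tnth_mktuple.
by case: eqP => //= _; rewrite (negbTE nouv).
Qed.

(** The recorded letter is the smaller of two distinct letters, so exactly one endpoint carries
    it. *)
Lemma lead_color t p (u v : word t p) : u != v ->
  (letter u (first (word_color u v)) == (word_color u v).1)
    != (letter v (first (word_color u v)) == (word_color u v).1).
Proof.
move=> /has_color /active_first; rewrite active_color /first /=.
set x := letter u _; set y := letter v _ => neq.
by case: ifP => _; rewrite eqxx ?[y == x]eq_sym (negbTE neq).
Qed.

(** * Separating the endpoints of edges with colours in a given set *)

Definition separable t p (Y : {set color t p}) (k : nat) : Prop :=
  exists2 f : word t p -> nat, (forall u, f u < k) &
    forall u v, u != v -> word_color u v \in Y -> f u <> f v.

Definition degree t p (Y : {set color t p}) (j : nat) : nat :=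
  #|[set c in Y | active c j]|.

(* Greedy: when the colour with the largest first index comes last, only the
   colours active at that index conflict with it. *)
Lemma greedy_groups t p (Y : {set color t p}) e :
    {in Y, forall c : color t p, true \in c.2} -> {in Y, forall c, degree Y (first c) <= e} ->
  exists2 g : color t p -> nat, {in Y, forall c, g c < e} &
    {in Y &, forall c c', c != c' -> g c = g c' -> ~~ active c (first c')}.
Proof.
have [m] := ubnP #|Y|; elim: m Y => // m IHm Y leYm hasY degY.
have [->|[c0 Yc0]] := set_0Vmem Y.
  by exists (fun=> 0) => [c|c c']; rewrite inE.
have [c /= Yc maxc] := @arg_maxnP _ c0 (fun c => c \in Y) (@first t p) Yc0.
set Z := Y :\ c.
have sZY c' : c' \in Z -> c' \in Y by rewrite !inE => /andP[].
have [|c' /sZY/hasY //|c' /sZY Yc'|g gle gP] := IHm Z.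
- by move: leYm; rewrite (cardsD1 c Y) Yc ltnS.
- apply: leq_trans (degY _ Yc'); apply/subset_leq_card/subsetP => b.
  by rewrite !inE => /andP[/andP[_ ->]].
set B := [set c' in Z | active c' (first c)].
have ltBe : #|B| < e.
  apply: leq_trans (degY _ Yc); rewrite /degree [in leqRHS](cardsD1 c) inE Yc active_first ?hasY //.
  rewrite ltnS; apply/subset_leq_card/subsetP => b.
  by rewrite !inE -andbA.
(* Fewer than [e] colours conflict with [c], so some group [k] contains none of them. *)
have /allPn[k kle kB] : ~~ all [in [seq g c' | c' <- enum B]] (iota 0 e).
  apply/negP => /allP sub; have := uniq_leq_size (iota_uniq 0 e) sub.
  by rewrite size_map -cardE size_iota leqNgt ltBe.
have gB c' : c' \in Y -> c' != c -> g c' = k -> ~~ active c' (first c).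
  move=> Yc' c'c gk; apply: contra kB => ac; rewrite -gk.
  by apply/map_f; rewrite mem_enum !inE c'c Yc'.
exists (fun c' => if c' == c then k else g c') => [c' Yc'|c1 c2 Y1 Y2].
  by case: eqP => [_|/eqP ?]; [rewrite mem_iota in kle | apply: gle; rewrite !inE Yc' andbT].
case: (eqVneq c1 c) => [->|c1c]; case: (eqVneq c2 c) => [->|c2c].
- by rewrite ?eqxx.
- move=> _ gk; apply/negP => ac.
  (* Activity of [c] at [first c2] gives one inequality, maximality of [first c] the other; then
     [c2] is active at [first c], against the choice of [k]. *)
  have fE : first c2 = first c.
    by apply/eqP; rewrite eqn_leq (maxc _ Y2) first_le.
  by have /negP[] := gB _ Y2 c2c (esym gk); rewrite -fE active_first ?hasY.
- by move=> _; apply: gB.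
by apply: gP; rewrite !inE ?c1c ?c2c.
Qed.

Lemma separable_fin t p (Y : {set color t p}) (C : finType) (f : word t p -> C) :
  (forall u v, u != v -> word_color u v \in Y -> f u <> f v) -> separable Y #|C|.
Proof.
move=> fP; exists (fun u => nat_of_ord (enum_rank (f u))) => [u|u v uv Yuv].
  exact: ltn_ord.
by move=> /ord_inj/enum_rank_inj; apply: fP.
Qed.

Lemma separable_low_degree t p (Y : {set color t p}) e :
    {in Y, forall c : color t p, true \in c.2} -> {in Y, forall c, degree Y (first c) <= e} ->
  separable Y (2 ^ e).
Proof.
move=> hasY degY; have [g ge gP] := greedy_groups hasY degY.
pose S (u : word t p) k := \sum_(c in Y | g c == k) (letter u (first c) == c.1).
pose F u : {ffun 'I_e -> bool} := [ffun k => odd (S u (val k))].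
have cardF : #|{ffun 'I_e -> bool}| = 2 ^ e by rewrite card_ffun card_bool card_ord.
rewrite -cardF; apply: separable_fin (F) _ => u v uv Yc.
move=> /ffunP/(_ (Ordinal (ge _ Yc))); rewrite !ffunE /S /=.
(* The term of the colour of [uv] differs between the two sums by [lead_color]. At the first index
   of any other colour of its group [u] and [v] agree, so the remaining terms coincide and the
   parities differ. *)
rewrite (bigD1 (word_color u v)) ?Yc ?eqxx //= [in RHS](bigD1 (word_color u v)) ?Yc ?eqxx //=.
rewrite !oddD !oddb.
rewrite (eq_bigr (fun c => nat_of_bool (letter v (first c) == c.1))).
  by have := lead_color uv => + /addIb E; rewrite E eqxx.
move=> c /andP[/andP[Y'c /eqP gc] cN].
have := gP _ _ Yc Y'c; rewrite eq_sym => /(_ cN (esym gc)).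
by rewrite active_color negbK => /eqP ->.
Qed.

Lemma separable_branch t p (Y : {set color t p}) c k1 k2 :
    separable [set c' in Y | ~~ active c' (first c)] k1 -> separable (Y :\ c) k2 ->
  separable Y (k1 + k2).
Proof.
move=> [f1 f1k f1P] [f2 f2k f2P].
(* The shift by [k1] keeps the values on the two sides disjoint. *)
exists (fun u => if letter u (first c) == c.1 then f1 u else k1 + f2 u) => [u|u v uv Yuv].
  by case: ifP; rewrite ?ltn_add2l ?f2k // => _; apply: ltn_addr.
case: eqP => [ua|/eqP ua]; case: eqP => [va|/eqP va].
- by apply: f1P; rewrite // inE Yuv active_color ua va eqxx.
- by move=> E; have := f1k u; rewrite E ltnNge leq_addr.
- by move=> E; have := f1k v; rewrite -E ltnNge leq_addr.
move/addnI; apply: f2P => //; rewrite !inE Yuv andbT; apply/eqP => E.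
by have := lead_color uv; rewrite E (negbTE ua) (negbTE va).
Qed.

(** The second hypothesis on [l] is the recursion L(s - 1) + L(s - e - 1) <= L(s) for L(s) =
    [l ^ s], divided by L(s - e - 1); the factor [2 ^ e] pays for the sets of low degree where
    branching stops. *)
Lemma separable_bound t p (Y : {set color t p}) e (l : R) :
    (1 <= l)%R -> (l ^ e + 1 <= l ^ e.+1)%R -> {in Y, forall c : color t p, true \in c.2} ->
  exists2 k, separable Y k & (INR k <= 2 ^ e * l ^ #|Y|)%R.
Proof.
move=> l1 le; have [m] := ubnP #|Y|; elim: m Y => // m IHm Y leYm hasY.
have p2 : (0 < 2 ^ e)%R by apply: pow_lt; lra.
have [/forall_inP low|] := boolP [forall c in Y, degree Y (first c) <= e].
  exists (2 ^ e); first exact: separable_low_degree.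
  have -> : INR (2 ^ e) = (2 ^ e)%R.
    by elim: (e) => // e' IH; rewrite expnS mult_INR IH.
  by have := pow_R1_Rle l #|Y| l1; nra.
case/forall_inPn => c Yc; rewrite -ltnNge => deg.
have [||k1 sep1 le1] := IHm [set c' in Y | ~~ active c' (first c)].
- rewrite -ltnS; apply: leq_trans leYm; rewrite ltnS; apply/proper_card/properP; split.
    by apply/subsetP => c'; rewrite inE => /andP[].
  by exists c; rewrite // inE Yc active_first ?hasY.
- by move=> c'; rewrite inE => /andP[/hasY].
have [||k2 sep2 le2] := IHm (Y :\ c).
- by move: leYm; rewrite (cardsD1 c Y) Yc ltnS.
- by move=> c'; rewrite !inE => /andP[_ /hasY].
exists (k1 + k2); first exact: separable_branch sep2.
set Y1 := [set _ in _ | _] in sep1 le1.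
have [r Yr] : exists r, #|Y| = r + e.+1.
  by exists (#|Y| - e.+1); rewrite subnK // (leq_trans deg) // subset_leq_card //;
    apply/subsetP => c'; rewrite inE => /andP[].
have Y2r : #|Y :\ c| = r + e.
  by have := cardsD1 c Y; rewrite Yc Yr addnS => -[].
have Y1r : #|Y1| <= r.
  rewrite -(leq_add2r e.+1) -Yr -(cardsID [set c' in Y | active c' (first c)] Y) addnC.
  apply: leq_add; first apply: leq_trans deg _.
    by apply/subset_leq_card/subsetP => c'; rewrite !inE => /andP[-> ->].
  by apply/subset_leq_card/subsetP => c'; rewrite !inE => /andP[-> ->].
rewrite Y2r pow_add in le2.
rewrite plus_INR Yr pow_add.
have := Rle_pow _ _ _ l1 (elimT leP Y1r).
have : (1 <= l ^ r)%R by apply: pow_R1_Rle.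
move=> ? ?.
have : (2 ^ e * l ^ #|Y1| <= 2 ^ e * l ^ r)%R by apply: Rmult_le_compat_l; lra.
have : (2 ^ e * (l ^ r * (l ^ e + 1)) <= 2 ^ e * (l ^ r * l ^ e.+1))%R.
  by do 2 (apply: Rmult_le_compat_l; first lra).
lra.
Qed.

(** * Rounding, logarithms and the choice of parameters *)

Lemma nfloor_spec x : (0 <= x)%R -> (INR (nfloor x) <= x < INR (nfloor x) + 1)%R.
Proof.
move=> x0; have [a b] := base_Int_part x.
have z0 : (0 <= Int_part x)%Z.
  by have : (-1 < Int_part x)%Z; [apply: lt_IZR; lra | lia].
by rewrite /nfloor INR_IZR_INZ Z2Nat.id //; lra.
Qed.

Lemma log2_pow2 x : (0 < x)%R -> Rpower 2 (log2 x) = x.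
Proof.
move=> x0; have := ln_lt_2 => ?.
by rewrite /Rpower /log2 /Rdiv Rmult_assoc Rinv_l ?Rmult_1_r ?exp_ln //; lra.
Qed.

Lemma log2_le x y : (0 < x <= y)%R -> (log2 x <= log2 y)%R.
Proof.
move=> [x0 xy]; have := ln_lt_2 => ?.
apply: Rmult_le_compat_r; first by apply/Rlt_le/Rinv_0_lt_compat; lra.
by case: (Req_dec x y) => [->|ne]; [lra | apply/Rlt_le/ln_increasing; lra].
Qed.

Lemma log2_2 : log2 2 = 1%R.
Proof. by have := ln_lt_2 => ?; rewrite /log2 Rdiv_diag //; lra. Qed.

Lemma INR_pow2 k : INR (2 ^ k) = Rpower 2 (INR k).
Proof.
rewrite Rpower_pow; last lra.
by elim: k => // k IH; rewrite expnS mult_INR IH.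
Qed.

Lemma log2_pow k : log2 (INR (2 ^ k)) = INR k.
Proof.
have := ln_lt_2 => ?.
by rewrite INR_pow2 /log2 /Rpower ln_exp Rmult_div_l //; lra.
Qed.

Lemma separable_color_set t p (Y : {set color t p}) s : 2 <= s -> #|Y| <= s ->
    {in Y, forall c : color t p, true \in c.2} ->
  exists2 k, separable Y k & (INR k <= Rpower 2 (3 * sqrt (INR s * log2 (INR s))))%R.
Proof.
move=> s2 Ys hasY; set q := sqrt _.
have S2 : (2 <= INR s)%R by have := le_INR _ _ (elimT leP s2).
have L1 : (1 <= log2 (INR s))%R by rewrite -log2_2; apply: log2_le; lra.
have qq : (q * q = INR s * log2 (INR s))%R by rewrite sqrt_sqrt //; nra.
(* From q^2 >= 2; it yields 2 + m <= s q = s^2 m below. *)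
have q14 : (14/10 <= q)%R.
  by have := sqrt_pos (INR s * log2 (INR s)); rewrite -/q; nra.
(* The growth rate [l = 2 ^ m] gives [l ^ s = 2 ^ q] and [l ^ e.+1 >= s ^ 2]. *)
set m := (q / INR s)%R.
have ms : (m * INR s = q)%R by rewrite /m; field; lra.
have m0 : (0 < m)%R by apply: Rdiv_lt_0_compat; lra.
have [e1 e2] := @nfloor_spec (2 * q) ltac:(lra).
set e := nfloor _ in e1 e2.
set l := Rpower 2 m.
have l0 : (0 < l)%R by apply: exp_pos.
have lm : (1 + m / 2 <= l)%R.
  have := exp_ineq1_le (m * ln 2); have := ln_lt_2; rewrite -/(Rpower 2 m) -/l; nra.
have lk k : (l ^ k = Rpower 2 (m * INR k))%R by rewrite -Rpower_mult Rpower_pow.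
(* As e + 1 > 2q, the exponent m (e + 1) is at least 2 q^2 / s = 2 log s. *)
have le1 : (INR s * INR s <= l ^ e.+1)%R.
  rewrite lk -{1 2}(@log2_pow2 (INR s)); last lra.
  by rewrite -Rpower_plus; apply: Rle_Rpower; [lra | rewrite S_INR; nra].
have [||//|k sepk kle] := @separable_bound t p Y e l; first lra.
  (* Adding (2 + m) l^e <= 2 l^(e+1) and 2 + m <= m s^2 <= m l^(e+1) gives the recursion multiplied
     by 2 + m. *)
  have El : (l ^ e.+1 = l * l ^ e)%R by [].
  have sm : (2 + m <= INR s * INR s * m)%R by nra.
  have le0 : (0 < l ^ e)%R by apply: pow_lt.
  have lel : ((2 + m) * l ^ e <= 2 * l ^ e.+1)%R by rewrite El; nra.
  have mle : (m * (INR s * INR s) <= m * l ^ e.+1)%R by apply: Rmult_le_compat_l; lra.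
  by apply: (Rmult_le_reg_l (2 + m)); lra.
exists k => //; apply: Rle_trans kle _.
have Pe : (2 ^ e = Rpower 2 (INR e))%R by rewrite Rpower_pow //; lra.
rewrite Pe lk -Rpower_plus; apply: Rle_Rpower; first lra.
have := le_INR _ _ (elimT leP Ys); nra.
Qed.

(** * Transfer to the complete graph *)

Lemma ex_injection (A B : finType) : #|A| <= #|B| -> exists f : A -> B, injective f.
Proof.
move=> leAB; exists (fun a => enum_val (widen_ord leAB (enum_rank a))).
by move=> a b /enum_val_inj/(congr1 val)/= /ord_inj/enum_rank_inj.
Qed.

Lemma chromatic_number_le n (E : rel 'I_n) (Eirr : irreflexive E) k (f : 'I_n -> nat) :
    (forall u, f u < k) -> (forall u v, E u v -> f u <> f v) ->
  chromatic_number Eirr <= k.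
Proof.
move=> fk fP; rewrite /chromatic_number; case: ex_minnP => m _; apply.
apply/existsP; exists [ffun u => Ordinal (fk u)].
apply/forallP => u; apply/forallP => v; apply/implyP => /fP fuv.
by rewrite !ffunE; apply/eqP => -[].
Qed.

(** For t > 0, minimality gives (t - 1)^2 <= log n, and n >= 2 gives 1 <= sqrt (log n), so 2t <= 4
    sqrt (log n). Rounding down is harmless because 2^(2t) is an integer. *)
Lemma word_length n : 0 < n ->
  exists2 t, n <= 2 ^ (t * t) & 2 ^ (2 * t) <= nfloor (Rpower 2 (6 * sqrt (log2 (INR n)))).
Proof.
move=> n0.
have ex : exists t, n <= 2 ^ (t * t).
  exists n; apply: leq_trans (ltnW (@ltn_expl 2 n isT)) _.
  by rewrite leq_exp2l // leq_pmulr.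
case: (ex_minnP ex) => t nt tmin; exists t => //.
have [F1 F2] := @nfloor_spec (Rpower 2 (6 * sqrt (log2 (INR n)))) (Rlt_le _ _ (exp_pos _)).
set N := nfloor _ in F1 F2 *.
suff : (INR (2 ^ (2 * t)) <= Rpower 2 (6 * sqrt (log2 (INR n))))%R.
  move=> h; rewrite -ltnS; apply/ltP/INR_lt; rewrite S_INR; lra.
rewrite INR_pow2; apply: Rle_Rpower; first lra.
have sq0 := sqrt_pos (log2 (INR n)).
case: t nt tmin => [|t] nt tmin; first by rewrite /=; lra.
have nlt : 2 ^ (t * t) < n by rewrite ltnNge; apply/negP => /tmin; rewrite ltnn.
have n2 : 2 <= n by apply: leq_trans nlt; rewrite ltnS expn_gt0.
have s1 : (1 <= sqrt (log2 (INR n)))%R.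
  rewrite -{1}sqrt_1 -log2_2; apply/sqrt_le_1_alt/log2_le.
  by have := le_INR _ _ (elimT leP n2); rewrite /=; lra.
have st : (INR t <= sqrt (log2 (INR n)))%R.
  rewrite -(sqrt_square (INR t)); last exact: pos_INR.
  rewrite -mult_INR -[Nat.mul t t]/(muln t t) -log2_pow; apply/sqrt_le_1_alt/log2_le.
  have := le_INR _ _ (elimT leP (ltnW nlt)).
  by split=> //; apply/lt_0_INR/ltP; rewrite expn_gt0.
by rewrite mult_INR (S_INR t) -[INR 2]/2%R; lra.
Qed.

Theorem theorem1p7 :
  forall n : nat, 0 < n ->
  exists c : 'I_n -> 'I_n -> 'I_(nfloor (Rpower 2 (6 * sqrt (log2 (INR n))))),
    (forall u v, c u v = c v u) /\
    forall X : {set 'I_(nfloor (Rpower 2 (6 * sqrt (log2 (INR n)))))},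
      2 <= #|X| ->
      (INR (chromatic_number (color_subgraph_irr c X))
        <= Rpower 2 (3 * sqrt (INR #|X| * log2 (INR #|X|))))%R.
Proof.
move=> n n0; have [t nt tN] := word_length n0.
set N := nfloor _ in tN *.
(* With p = 2^t - 1 there are 2^(t*t) words and 2^(2t) colours. *)
have p1 : (2 ^ t).-1.+1 = 2 ^ t by rewrite prednK ?expn_gt0.
have [|w w_inj] := @ex_injection 'I_n (word t (2 ^ t).-1).
  by rewrite card_tuple !card_ord p1 -expnM.
have [|h h_inj] := @ex_injection (color t (2 ^ t).-1) 'I_N.
  by rewrite card_prod card_tuple !card_ord card_bool p1 -expnD addnn -mul2n.
exists (fun u v => h (word_color (w u) (w v))); split=> [u v|X X2].
  congr h; rewrite /word_color.
  have -> : diff (w v) (w u) = diff (w u) (w v).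
    by apply: eq_from_tnth => j; rewrite !tnth_mktuple eq_sym.
  congr pair; case: ltngtP => // E; apply: val_inj; by rewrite /= E.
(* Colours with an all-[false] pattern occur on no edge and are discarded. *)
pose Y := [set k in h @^-1: X | true \in k.2].
have [||k [f fk fP] kle] := @separable_color_set _ _ Y #|X| X2.
- rewrite -(card_imset _ h_inj); apply/subset_leq_card/subsetP => x.
  by case/imsetP => k; rewrite !inE => /andP[? _] ->.
- by move=> k; rewrite !inE => /andP[].
apply: Rle_trans kle; apply/le_INR/leP.
apply: (@chromatic_number_le _ _ _ k (fun u => f (w u))) => [//|u v /andP[uv cX]].
have wuv : w u != w v by apply: contra_neq uv => /w_inj.
by apply: fP; rewrite // !inE cX has_color.
Qed.
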